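(* Suppose that $Y\to X\to X/Y$ is a short exact sequence of Banach spaces, $X$ is a $\mathcal{L}_\infty$ space, and $Y$ has the approximation property. Then the pair $(X,Y)$ has the approximation property and hence $X/Y$ has the approximation property.
   Context: $L(X)$ is the space of bounded linear operators on the Banach space $X$, and $\tau$ is the topology on $L(X)$ of uniform convergence on compact subsets of $X$. Subspaces are closed. A Banach space $X$ has the approximation property (AP) if the identity on $X$ is the $\tau$-limit of a net of finite rank bounded linear operators on $X$. For a subspace $Y$ of $X$, the pair $(X,Y)$ has the approximation property (AP) if the identity on $X$ is the $\tau$-limit of a net of finite rank bounded linear operators on $X$ all of which leave $Y$ invariant. A sequence $Y\to X\to Z$ of Banach spaces is a short exact sequence when the operator $Y\to X$ is an isomorphic embedding and the operator $X\to Z$ is surjective and has (the image of) $Y$ as its kernel. Up to passing to equivalent norms, this just says that $Y$ is a subspace of $X$ and $Z$ is the quotient space $X/Y$; $Y$ is regarded as a subspace of $X$ via the embedding. A Banach space $X$ is $\mathcal{L}_\infty$ if there is $\lambda<\infty$ such that every finite dimensional subspace of $X$ is contained in a finite dimensional subspace $F$ of $X$ whose Banach–Mazur distance to $\ell_\infty^{\dim F}$ is at most $\lambda$. *)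

(* Defs.v *)
From HB Require Import structures.
From mathcomp Require Import all_boot all_order all_algebra.
From mathcomp Require Import all_classical all_reals all_analysis.
From mathcomp Require Export complex.
Export numFieldNormedType.Exports.

Set Implicit Arguments.
Unset Strict Implicit.
Unset Printing Implicit Defensive.

Import Order.TTheory GRing.Theory Num.Theory.

Local Open Scope classical_set_scope.
Local Open Scope ring_scope.
Local Open Scope complex_scope.

(* A Banach space is a completeNormedModType K, where K is a model of the real
   field or the complex field over such a model.  In the complex case norms
   take their values in the nonnegative reals inside R[i], and x <= y in R[i]
   means that y - x is a nonnegative real. *)
Inductive real_or_complex : numFieldType -> Prop :=
| scalars_real (R : realType) : real_or_complex R
| scalars_complex (R : realType) : real_or_complex R[i].

Definition lspan (K : numFieldType) (X : lmodType K) (n : nat)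
    (v : 'I_n -> X) : set X :=
  [set x | exists c : 'I_n -> K, x = \sum_(j < n) c j *: v j].

Definition finite_dim_subspace (K : numFieldType) (X : lmodType K)
    (E : set X) : Prop :=
  exists (n : nat) (v : 'I_n -> X), E = lspan v.

Definition finite_rank (K : numFieldType) (X : lmodType K)
    (T : {linear X -> X}) : Prop :=
  finite_dim_subspace (range T).

Definition directed (I : Type) (le : I -> I -> Prop) : Prop :=
  [/\ inhabited I,
      (forall s, le s s),
      (forall s t u, le s t -> le t u -> le s u) &
      forall s t, exists u, le s u /\ le t u].

Definition tails (I : Type) (le : I -> I -> Prop) : set_system I :=
  [set A | exists s, forall t, le s t -> A t].

(* The identity of X is the limit, uniformly on compact sets, of a net of
   bounded linear operators satisfying P. *)
Definition id_net_limit (K : numFieldType) (X : normedModType K)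
    (P : {linear X -> X} -> Prop) : Prop :=
  exists (I : Type) (le : I -> I -> Prop) (T : I -> {linear X -> X}),
    [/\ directed le,
        (forall t, continuous (T t)),
        (forall t, P (T t)) &
        {family compact, (fun t => T t : X -> X) @ tails le --> (id : X -> X)}].

Definition approximation_property (K : numFieldType) (X : normedModType K) :
    Prop :=
  id_net_limit (@finite_rank K X).

Definition pair_approximation_property (K : numFieldType)
    (X : normedModType K) (Y : set X) : Prop :=
  id_net_limit (fun T : {linear X -> X} =>
    finite_rank T /\ forall y, Y y -> Y (T y)).

Definition short_exact (K : numFieldType) (Y X Z : normedModType K)
    (i : {linear Y -> X}) (q : {linear X -> Z}) : Prop :=
  [/\ continuous i,
      (exists2 c : K, 0 < c & forall y, c * `|y| <= `|i y|),
      continuous q,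
      (forall z, exists x, q x = z) &
      [set x | q x = 0] = range i].

(* The numbers a * b with ||T|| <= a and ||T^-1|| <= b, for T a linear
   isomorphism of V onto the subspace F. *)
Definition isomorphism_constants (K : numFieldType) (V X : normedModType K)
    (F : set X) : set K :=
  [set c | exists (T : {linear V -> X}) (a b : K),
    [/\ injective T, range T = F, 0 <= a /\ 0 <= b,
        (forall v, `|T v| <= a * `|v|) /\ (forall v, `|v| <= b * `|T v|) &
        c = a * b]].

(* The Banach-Mazur distance inf ||T|| ||T^-1|| from V to F is at most lambda.
   The infimum over the empty set is infinite. *)
Definition banach_mazur_le (K : numFieldType) (V X : normedModType K)
    (F : set X) (lambda : K) : Prop :=
  forall mu : K, lambda < mu ->
    exists2 c, @isomorphism_constants K V X F c & c < mu.

(* 'rV[K]_n carries the supremum norm, i.e. it is l_infty^n; an isomorphism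
   onto F forces n to be the dimension of F. *)
Definition Linfty_space (K : numFieldType) (X : normedModType K) : Prop :=
  exists2 lambda : K, 0 <= lambda &
    forall E : set X, finite_dim_subspace E ->
      exists F : set X,
        [/\ finite_dim_subspace F, E `<=` F &
            exists n : nat, banach_mazur_le 'rV[K]_n F lambda].

(* Main.v *)
Require Import Defs.
From HB Require Import structures.
From mathcomp Require Import all_boot all_order all_algebra.
From mathcomp Require Import all_classical all_reals all_analysis.
From mathcomp Require Import ring lra.

(* Let A be a finite rank operator on Y that is close to the identity on a
   compact set, and let B be a finite rank extension of i A i^-1 to X, with values
   in Y and of uncontrolled norm.  Let F be isomorphic to l_infty^n and almost
   contain (1 - B) C, where C is a given compact set; by Hahn-Banach in each
   coordinate there is a projection P of X onto F, of norm bounded independently of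
   F.  On Y the operator B + P (1 - B) differs from A by P (1 - A), which has n
   coordinates; each is small on Y intersected with the closed absolutely convex
   hull of C, hence extends to a functional on X which is small on C.
   Subtracting these extensions gives an operator that equals A on Y and is close
   to the identity on C.

   For the quotient, q is open and compact sets lift through q, so an operator on X
   that leaves the kernel Y of q invariant induces the required operator on Z. *)

Set Implicit Arguments.
Unset Strict Implicit.
Unset Printing Implicit Defensive.

Import Order.TTheory GRing.Theory Num.Theory.

Local Open Scope classical_set_scope.
Local Open Scope ring_scope.

(** * The Hahn-Banach theorem *)

Lemma linear_pack (K : numFieldType) (V W : lmodType K) (f : V -> W) :
  linear f -> exists F : {linear V -> W}, forall x, F x = f x.
Proof.
move=> lf; pose F : {linear V -> W} := HB.pack f (GRing.isLinear.Build _ _ _ _ _ lf).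
by exists F.
Qed.

(* G x r stands for p x <= r with p sublinear; a relation avoids infima, which
   K does not have when it is complex. *)
Section RealHahnBanach.
Variables (R : realType) (K : numFieldType) (io : {rmorphism R -> K}).
Variables (V : lmodType K) (G : V -> R -> Prop).
Hypothesis G_total : forall x, exists r, G x r.
Hypothesis GD : forall x y r s, G x r -> G y s -> G (x + y) (r + s).
Hypothesis GZ : forall a x r, 0 <= a -> G x r -> G (io a *: x) (a * r).

(** Partial real functionals are encoded by their graphs. Single-valuedness follows from the
    domination: the difference of two values at [x] is a value at 0, and [G 0 0] bounds it by 0. *)
Let good (F : set (V * R)) :=
  [/\ F (0, 0),
      (forall a x s y t, F (x, s) -> F (y, t) -> F (io a *: x + y, a * s + t)) &
      (forall x s r, F (x, s) -> G x r -> s <= r)].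

Let good_fun F x s t : good F -> F (x, s) -> F (x, t) -> s = t.
Proof.
move=> [F0 FL Fdom] Fs Ft.
have [r0 Gr0] := G_total 0.
have G0 : G 0 0 by have := GZ (lexx 0) Gr0; rewrite scaler0 mul0r.
have h u v : F (x, u) -> F (x, v) -> v - u <= 0.
  move=> Fu Fv; apply: Fdom G0.
  have := FL (-1) _ _ _ _ Fu Fv.
  by rewrite rmorphN1 scaleN1r addNr mulN1r addrC.
by apply/eqP; rewrite eq_le -subr_le0 (h _ _ Ft Fs) -subr_le0 (h _ _ Fs Ft).
Qed.

(** The one-dimensional step. By subadditivity every [s - r] with [G (y - x0) r] lies below every
    [r' - s'] with [G (y' + x0) r'], so the supremum [al] of the former is an admissible value at
    [x0]. *)
Let good_extend F x0 : good F -> exists2 F', good F' & F `<=` F' /\ exists s, F' (x0, s).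
Proof.
move=> gF; have [F0 FL Fdom] := gF.
have FD x s y t : F (x, s) -> F (y, t) -> F (x + y, s + t).
  by move=> Fx Fy; have := FL 1 _ _ _ _ Fx Fy; rewrite rmorph1 scale1r mul1r.
have FZ a x s : F (x, s) -> F (io a *: x, a * s).
  by move=> Fx; have := FL a _ _ _ _ Fx F0; rewrite !addr0.
pose L := [set l | exists y s r, [/\ F (y, s), G (y - x0) r & l = s - r]].
have L0 : L !=set0.
  have [r Gr] := G_total (0 - x0).
  by exists (0 - r), 0, 0, r.
have LU y s r : F (y, s) -> G (y + x0) r -> ubound L (r - s).
  move=> Fy Gr _ [y' [s' [r' [Fy' Gr' ->]]]].
  have : s' + s <= r' + r.
    apply: (Fdom (y' + y)); first exact: FD.
    by have := GD Gr' Gr; rewrite addrACA addNr addr0.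
  by lra.
have hsup : has_sup L.
  split=> //; have [r Gr] := G_total (0 + x0).
  by exists (r - 0); apply: (LU 0).
set al := sup L.
have al1 y s r : F (y, s) -> G (y + x0) r -> s + al <= r.
  by move=> Fy Gr; have := ge_sup L0 (LU _ _ _ Fy Gr); rewrite -/al; lra.
have al2 y s r : F (y, s) -> G (y - x0) r -> s - al <= r.
  move=> Fy Gr; have : s - r <= al by apply: sup_upper_bound => //; exists y, s, r.
  lra.
pose F' : set (V * R) :=
  [set p | exists y s a, F (y, s) /\ p = (y + io a *: x0, s + a * al)].
exists F'; last split.
- split.
  + by exists 0, 0, 0; rewrite rmorph0 scale0r mul0r !addr0.
  + move=> c _ _ _ _ [y [s [a [Fy [-> ->]]]]] [y' [s' [a' [Fy' [-> ->]]]]].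
    exists (io c *: y + y'), (c * s + s'), (c * a + a').
    split; first exact: FL.
    congr pair; last by ring.
    by rewrite rmorphD rmorphM scalerDr scalerDl scalerA addrACA.
  + move=> _ _ r [y [s [a [Fy [-> ->]]]]] Gr.
    have iou b : b != 0 -> io b^-1 * io b = 1.
      by move=> b0; rewrite -rmorphM mulVf// rmorph1.
    (* Dividing by the absolute value of [a] reduces the two nonzero cases to [al2] and [al1]. *)
    case: (ltgtP a 0) => [a0|a0|a0].
    * have n0 : 0 < - a by rewrite oppr_gt0.
      have nV0 : 0 <= (- a)^-1 by rewrite invr_ge0 ltW.
      have h : (- a)^-1 * s - al <= (- a)^-1 * r.
        apply: (al2 _ _ _ (FZ (- a)^-1 _ _ Fy)).
        have := GZ nV0 Gr; rewrite scalerDr scalerA invrN rmorphN mulNr.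
        by rewrite iou ?lt_eqF// scaleN1r.
      rewrite -(ler_pM2l n0) mulrBr !mulrA divff ?gt_eqF// !mul1r in h.
      by move: h; lra.
    * have nV0 : 0 <= a^-1 by rewrite invr_ge0 ltW.
      have h : a^-1 * s + al <= a^-1 * r.
        apply: (al1 _ _ _ (FZ a^-1 _ _ Fy)).
        by have := GZ nV0 Gr; rewrite scalerDr scalerA iou ?gt_eqF// scale1r.
      rewrite -(ler_pM2l a0) mulrDr !mulrA divff ?gt_eqF// !mul1r in h.
      by move: h; lra.
    * rewrite a0 rmorph0 scale0r addr0 in Gr *.
      by rewrite mul0r addr0; apply: Fdom Gr.
- by move=> [y s] Fy; exists y, s, 0; rewrite rmorph0 scale0r mul0r !addr0.
- by exists (0 + 1 * al), 0, 0, 1; rewrite rmorph1 scale1r !add0r.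
Qed.

Lemma real_hahn_banach (F0 : set (V * R)) :
    F0 (0, 0) ->
    (forall a x s y t, F0 (x, s) -> F0 (y, t) -> F0 (io a *: x + y, a * s + t)) ->
    (forall x s r, F0 (x, s) -> G x r -> s <= r) ->
  exists f : V -> R,
    [/\ (forall a x y, f (io a *: x + y) = a * f x + f y),
        (forall x s, F0 (x, s) -> f x = s) &
        (forall x r, G x r -> f x <= r)].
Proof.
move=> F00 F0L F0dom.
have g0 : good F0 by [].
(* Zorn's lemma is applied to sets that become good after adjoining [F0], so that the empty chain,
   whose union is empty, also has a bound. *)
have [A [gA Amax]] : exists A, good (A `|` F0) /\
    forall B, A `<` B -> ~ good (B `|` F0).
  apply: (@Zorn_bigcup _ (fun A => good (A `|` F0))) => C Cgood Ctot.
  set U := \bigcup_(X in C) X.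
  have FU X : C X -> X `|` F0 `<=` U `|` F0.
    by move=> CX p [Xp|]; [left; exists X|right].
  split; first by right.
  - have two p p' : (U `|` F0) p -> (U `|` F0) p' -> exists B,
        [/\ good B, B p, B p' & B `<=` U `|` F0].
      move=> [[X CX Xp]|Fp] [[X' CX' Xp']|Fp'].
      + case: (Ctot _ _ CX CX') => XX.
        * by exists (X' `|` F0); split; [exact: Cgood|left; exact: XX|left|exact: FU].
        * by exists (X `|` F0); split; [exact: Cgood|left|left; exact: XX|exact: FU].
      + by exists (X `|` F0); split; [exact: Cgood|left|right|exact: FU].
      + by exists (X' `|` F0); split; [exact: Cgood|right|left|exact: FU].
      + by exists F0; split=> // q; right.
    move=> a x s y t Us Ut.
    by have [B [[_ BL _] Bs Bt BU]] := two _ _ Us Ut; apply/BU/BL.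
  - move=> x s r [[X CX Xs]|Fs]; last exact: F0dom.
    by have [_ _] := Cgood X CX; apply; left.
set F := A `|` F0 in gA.
have tot x : exists s, F (x, s).
  have [F' gF' [FF' [s F's]]] := good_extend x gA.
  have F'E : F' `|` F0 = F'.
    by apply/setUidPl => p Fp; apply: FF'; right.
  exists s; left; apply: contrapT => As.
  apply: (Amax F'); last by rewrite F'E.
  split; last by move=> /(_ _ F's).
  by move=> p Ap; apply: FF'; left.
have [f Ff] := choice tot.
have [_ FL Fdom] := gA.
exists f; split.
- by move=> a x y; apply: (good_fun gA (Ff _)); apply: FL.
- by move=> x s Fs; apply: (good_fun gA (Ff _)); right.
- by move=> x r; apply: Fdom (Ff x).
Qed.

End RealHahnBanach.

Local Open Scope complex_scope.

(** A complex functional is determined by its real part [g]; this is the formula that recovers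
    it. *)
Lemma complex_functional (R : realType) (V : lmodType R[i]) (g : V -> R) :
    (forall a x y, g (a%:C *: x + y) = a * g x + g y) ->
  forall a x y, let f x := (g x)%:C - 'i%C * (g ('i%C *: x))%:C in
    f (a *: x + y) = a * f x + f y.
Proof.
move=> gL [a b] x y /=.
have g0 : g 0 = 0.
  by have := gL 1 0 0; rewrite scaler0 addr0 mul1r; lra.
have gD u v : g (u + v) = g u + g v.
  by have := gL 1 u v; rewrite rmorph1 scale1r mul1r.
have gZ c u : g (c%:C *: u) = c * g u.
  by have := gL c u 0; rewrite addr0 g0 addr0.
have ab : Complex a b = a%:C + b%:C * 'i%C by rewrite [LHS]complexE /= mulrC.
have ii : 'i%C * 'i%C = (-1)%:C :> R[i] by rewrite -expr2 sqr_i rmorphN1.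
have e1 : Complex a b *: x = a%:C *: x + b%:C *: ('i%C *: x).
  by rewrite ab scalerDl !scalerA.
have e2 : 'i%C *: (Complex a b *: x) = a%:C *: ('i%C *: x) + (- b)%:C *: x.
  rewrite ab !scalerA -scalerDl; congr (_ *: x).
  by rewrite mulrDr mulrCA ii mulrC -rmorphM mulrN1.
rewrite scalerDr e2 e1 !gD !gZ ab.
rewrite !(rmorphD, rmorphM, rmorphN, rmorph1) /=.
set i := 'i%C in ii *. set u := (g x)%:C. set v := (g (i *: x))%:C.
move: ii; rewrite rmorphN rmorph1 => ii.
transitivity (a%:C * u + b%:C * v + (g y)%:C
  - i * (a%:C * v - b%:C * u + (g (i *: y))%:C)); first by ring.
(* For [ring] the imaginary unit is an indeterminate, so the difference of the two sides is
   displayed as a multiple of [1 + i * i]. *)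
have -> : a%:C * u + b%:C * v + (g y)%:C - i * (a%:C * v - b%:C * u + (g (i *: y))%:C)
   = (a%:C + b%:C * i) * (u - i * v) + ((g y)%:C - i * (g (i *: y))%:C)
     + (b%:C * v) * (1 + i * i) by ring.
by rewrite ii subrr mulr0 addr0.
Qed.

(** In the real case the lower bound follows from the upper one at [- x]. In the complex case the
    real parts of the prescribed values are extended to a real functional, which is then
    complexified. *)
Theorem hahn_banach (K : numFieldType) (hK : real_or_complex K) (V : lmodType K)
    (G F0 : V -> K -> Prop) :
    (forall x, exists r, G x r) ->
    (forall x r, G x r -> 0 <= r) ->
    (forall x y r s, G x r -> G y s -> G (x + y) (r + s)) ->
    (forall a x r, G x r -> G (a *: x) (`|a| * r)) ->
    F0 0 0 ->
    (forall a x s y t, F0 x s -> F0 y t -> F0 (a *: x + y) (a * s + t)) ->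
    (forall x s r, F0 x s -> G x r -> `|s| <= r) ->
  exists f : V -> K,
    [/\ (forall a x y, f (a *: x + y) = a * f x + f y),
        (forall x s, F0 x s -> f x = s) &
        (forall x r, G x r -> `|f x| <= r)].
Proof.
case: K / hK V G F0 => R V G F0 Gtot Gge0 GD GZ F00 F0L F0dom.
  have [|||f [fL fF fG]] := @real_hahn_banach R R idfun V G Gtot GD _
      (fun p => F0 p.1 p.2) F00.
  - by move=> a x r a0 Gr; have := GZ a _ _ Gr; rewrite ger0_norm.
  - by move=> a x s y t; exact: F0L.
  - move=> x s r Fs Gr; exact: le_trans (ler_norm _) (F0dom _ _ _ Fs Gr).
  exists f; split=> // x r Gr; rewrite ler_norml fG// andbT lerNl.
  have fN : f (- x) = - f x.
    have f0 : f 0 = 0 by have := fL 1 0 0; rewrite scaler0 addr0 mul1r; lra.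
    by have := fL (-1) x 0; rewrite scaleN1r !addr0 f0 addr0 mulN1r.
  by rewrite -fN fG//; have := GZ (-1) _ _ Gr; rewrite scaleN1r normrN1 mul1r.
have Grl x r : G x r -> r = (complex.Re r)%:C by move=> /Gge0/ger0_real/RRe_real.
have [||||||g [gL gF gG]] := @real_hahn_banach R R[i] (real_complex R) V
    (fun x r => G x r%:C) _ _ _ (fun p => exists2 t, F0 p.1 t & p.2 = complex.Re t) _.
- by move=> x; have [r Gr] := Gtot x; exists (complex.Re r); rewrite -(Grl x r).
- by move=> x y r s Gr Gs; rewrite rmorphD; exact: GD.
- move=> a x r a0 Gr; have := GZ a%:C _ _ Gr.
  by rewrite ger0_norm ?ler0c// -rmorphM.
- by exists 0.
- move=> a x s' y t' [s Fs /= ->] [t Ft /= ->].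
  exists (a%:C * s + t); first exact: F0L.
  by case: s t {Fs Ft} => [s1 s2] [t1 t2] /=; rewrite mul0r subr0.
- move=> x s' r [s Fs /= ->] Gr; rewrite -lecR.
  apply: le_trans (F0dom _ _ _ Fs Gr); apply: le_trans (normc_ge_Re _).
  by rewrite lecR ler_norm.
pose f x := (g x)%:C - 'i%C * (g ('i%C *: x))%:C.
have fL a x y : f (a *: x + y) = a * f x + f y by exact: complex_functional.
have f0 : f 0 = 0.
  by have := fL 0 0 0; rewrite scaler0 addr0 mul0r add0r => _; have := fL 1 0 0;
    rewrite scaler0 addr0 mul1r => /eqP; rewrite -subr_eq0 opprD addNKr oppr_eq0 => /eqP.
exists f; split=> //.
  move=> x s Fs; rewrite /f (gF x (complex.Re s)); last by exists s.
  rewrite (gF _ (complex.Re ('i%C * s))); last first.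
    by exists ('i%C * s) => //; have := F0L 'i%C _ _ _ _ Fs F00; rewrite !addr0.
  by rewrite [RHS]complexE (mulrC _ s) ReiNIm rmorphN mulrN opprK.
move=> x r Gr.
have [->|fx0] := eqVneq (f x) 0; first by rewrite normr0; exact: Gge0 Gr.
(* Rotating [x] by the unimodular [u] makes the value of [f] real and nonnegative, hence equal to
   that of [g], which [G] dominates. *)
pose u := `|f x| / f x.
have nu : `|u| = 1 by rewrite normrM normfV normr_id divff// normr_eq0.
have fu : f (u *: x) = `|f x|.
  by have := fL u x 0; rewrite !addr0 f0 addr0 => ->; rewrite mulfVK.
have Gu : G (u *: x) r by have := GZ u _ _ Gr; rewrite nu mul1r.
have : (complex.Re (f (u *: x)))%:C <= r.
  rewrite (Grl _ _ Gr) lecR.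
  have -> : complex.Re (f (u *: x)) = g (u *: x) by rewrite /f /=; ring.
  by apply: gG; rewrite -(Grl _ _ Gr).
by rewrite RRe_real fu// normr_real.
Qed.

Local Close Scope complex_scope.

(** * Totally bounded sets and absolutely convex hulls *)

Definition totally_bounded (K : numFieldType) (X : normedModType K) (A : set X) :=
  forall e : K, 0 < e ->
    exists s : seq X, forall x, A x -> exists2 y, y \in s & `|x - y| < e.

Lemma compact_totally_bounded (K : numFieldType) (X : normedModType K) (A : set X) :
  compact A -> totally_bounded A.
Proof.
move=> /compact_near_coveringP cA e e0; apply: contrapT => nos.
(* The filter generated by the lists that contain a given list: each point is approximated by all
   large lists, and compactness yields one list for all of [A]. *)
pose F : set_system (seq X) := [set P : set (seq X) |
  exists s0 : seq X, forall s : seq X, {subset s0 <= s} -> P s].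
have FF : Filter F.
  split.
  - by exists [::].
  - move=> P Q [s Ps] [t Qt]; exists (s ++ t) => u stu.
    by split; [apply: Ps|apply: Qt] => x xs; apply: stu; rewrite mem_cat xs ?orbT.
  - by move=> P Q PQ [s Ps]; exists s => u /Ps /PQ.
have := cA _ F (fun s x => exists2 y, y \in s & `|x - y| < e) FF.
case.
  move=> x Ax; exists (ball x e, [set s : seq X | x \in s]).
    split; first exact: nbhsx_ballx.
    by exists [:: x] => s; apply; rewrite inE.
  move=> [x' s] [/=]; rewrite -ball_normE /= => xx' xs.
  by exists x => //; rewrite distrC.
move=> s0 /(_ s0 (fun x xs => xs)) As; apply: nos.
by exists s0 => x /As.
Qed.

(** An ultrafilter on a set covered by finitely many small balls contains one of them; it is
    therefore Cauchy and converges by completeness. *)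
Lemma totally_bounded_closure (K : numFieldType) (X : completeNormedModType K)
  (A : set X) : totally_bounded A -> compact (closure A).
Proof.
move=> tbA; rewrite compact_ultra => F UF FA.
have Fcvg : cvg F.
  apply: cauchy_cvg; apply: cauchy_exP => e e0.
  have e2 : 0 < e / 2 by rewrite divr_gt0.
  have [s sA] := tbA _ e2.
  have : F [set x | exists2 y, y \in s & `|x - y| < e].
    apply: filterS FA => x clAx.
    have [z [Az xz]] := clAx _ (nbhsx_ballx x _ e2).
    have [y ys zy] := sA z Az; exists y => //.
    move: xz; rewrite -ball_normE /= => xz.
    rewrite (le_lt_trans (ler_distD z _ _))// [e]splitr.
    exact: ltrD.
  elim: s {sA} => [|y s IH] Fs.
    have [x [y]] := filter_ex Fs; by rewrite in_nil.
  have [Fy|Fy] := in_ultra_setVsetC (ball y e) UF; first by exists y.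
  apply: IH; apply: (filterS _ (filterI Fs Fy)) => x [[z]].
  rewrite inE => /predU1P[->|zs] xz nb; last by exists z.
  by case: nb; rewrite -ball_normE /= distrC.
have /cvg_ex[l Fl] := Fcvg.
exists l; split=> //; apply: closed_closure => B lB.
exact: filter_ex (filterI FA (Fl _ lB)).
Qed.

Lemma half_expn_lt (K : numFieldType) (hK : real_or_complex K) (e : K) :
  0 < e -> exists n, 2^-1 ^+ n < e.
Proof.
have real (R : realType) (r : R) : 0 < r -> exists n, 2^-1 ^+ n < r.
  move=> r0; have [n] : \forall n \near \oo, 2^-1 ^+ n < r.
    have /cvgrPdist_lt/(_ _ r0) : (2^-1 : R) ^+ n @[n --> \oo] --> 0.
      by apply: cvg_expr; rewrite ger0_norm ?invr_ge0// invf_lt1// ltr1n.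
    apply: filterS => n; rewrite sub0r normrN; apply: le_lt_trans.
    exact: ler_norm.
  by move=> _ /(_ n (leqnn n)) h; exists n.
case: K / hK e => R e e0; first exact: real.
have eE : e = (complex.Re e)%:C%C by rewrite RRe_real// gtr0_real.
have [n hn] := real R (complex.Re e) ltac:(by rewrite -ltcR -eE).
by exists n; rewrite eE -[2](rmorph_nat (real_complex R)) -fmorphV -rmorphXn ltcR.
Qed.

(** The real case is a compact interval; a complex net is formed from real nets for the real and
    imaginary parts. *)
Lemma scalar_totally_bounded (K : numFieldType) (hK : real_or_complex K) :
  totally_bounded [set a : K | `|a| <= 1].
Proof.
have real (R : realType) : totally_bounded [set a : R | `|a| <= 1].
  apply: compact_totally_bounded.
  rewrite (_ : mkset _ = `[-1, 1]%classic); first exact: segment_compact.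
  by apply/seteqP; split=> x /=; rewrite in_itv /= ler_norml.
case: K / hK => R; first exact: real.
move=> e e0.
have eE : e = (complex.Re e)%:C%C by rewrite RRe_real// gtr0_real.
have e2 : 0 < complex.Re e / 2 by rewrite divr_gt0// -ltcR -eE.
have [s sP] := real R _ e2.
exists [seq Complex x y | x <- s, y <- s] => -[a b] /= ab1.
have [a1 b1] : `|a| <= 1 /\ `|b| <= 1.
  split; rewrite -lecR rmorph1; apply: le_trans ab1.
    exact: (normc_ge_Re (Complex a b)).
  have := normc_ge_Re (Complex a b * 'i%C); rewrite ReiNIm normrN normrM.
  by rewrite [X in _ * X](_ : _ = 1) ?mulr1// normc_def /= expr0n add0r expr1n sqrtr1.
have [x xs ax] := sP a a1; have [y ys yb] := sP b b1.
exists (Complex x y); first by apply/allpairsP; exists (x, y).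
have -> : Complex a b - Complex x y = (a - x)%:C%C + 'i%C * (b - y)%:C%C.
  by rewrite [LHS]complexE.
apply: le_lt_trans (ler_normD _ _) _.
rewrite normrM [X in X * _](_ : _ = 1); last first.
  by rewrite normc_def /= expr0n add0r expr1n sqrtr1.
have nR (r : R) : `|r%:C%C| = `|r|%:C%C.
  by rewrite normc_def /= expr0n addr0 sqrtr_sqr.
rewrite mul1r !nR -rmorphD eE ltcR [ltRHS]splitr.
exact: ltrD.
Qed.

Definition abs_convex (K : numFieldType) (X : lmodType K) (A : set X) :=
  A 0 /\ forall a b x y, `|a| + `|b| <= 1 -> A x -> A y -> A (a *: x + b *: y).

Definition abs_hull (K : numFieldType) (X : lmodType K) (C : set X) : set X :=
  [set x | forall A, abs_convex A -> C `<=` A -> A x].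

Lemma sub_abs_hull (K : numFieldType) (X : lmodType K) (C : set X) :
  C `<=` abs_hull C.
Proof. by move=> x Cx A _; apply. Qed.

Lemma abs_hull_abs_convex (K : numFieldType) (X : lmodType K) (C : set X) :
  abs_convex (abs_hull C).
Proof.
split=> [A [] //|a b x y ab hx hy A cA CA].
by apply: cA.2 => //; [exact: hx|exact: hy].
Qed.

(** Each coefficient ranges over the unit disc independently. The set may exceed the absolutely
    convex hull of [s], but its total boundedness is a direct induction. *)
Fixpoint seq_hull (K : numFieldType) (X : lmodType K) (s : seq X) : set X :=
  if s is x :: s' then
    [set a *: x + y | a in [set a : K | `|a| <= 1] & y in seq_hull s']
  else [set 0].

Lemma seq_hull_abs_convex (K : numFieldType) (X : lmodType K) (s : seq X) :
  abs_convex (seq_hull s).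
Proof.
elim: s => [|x s [IH0 IH]] /=.
  by split=> // a b x y _ -> ->; rewrite !scaler0 addr0.
split; first by exists 0; [rewrite /= normr0|exists 0; rewrite // scale0r addr0].
move=> a b _ _ ab [c c1 [y hy <-]] [d d1 [z hz <-]].
exists (a * c + b * d).
  apply: le_trans ab; apply: le_trans (ler_normD _ _) _.
  by rewrite !normrM lerD// ler_piMr.
exists (a *: y + b *: z); first exact: IH.
by rewrite scalerDl !scalerDr !scalerA addrACA.
Qed.

Lemma mem_seq_hull (K : numFieldType) (X : lmodType K) (s : seq X) x :
  x \in s -> seq_hull s x.
Proof.
elim: s => // y s IH; rewrite inE => /predU1P[->|xs].
  exists 1; first by rewrite /= normr1.
  by exists 0; rewrite ?scale1r ?addr0//; have [] := seq_hull_abs_convex s.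
exists 0; first by rewrite /= normr0.
by exists x; rewrite ?scale0r ?add0r//; apply: IH.
Qed.

Lemma seq_hull_totally_bounded (K : numFieldType) (hK : real_or_complex K)
  (X : normedModType K) (s : seq X) : totally_bounded (seq_hull s).
Proof.
elim: s => [|x s IH] e e0 /=.
  by exists [:: 0] => x ->; exists 0; rewrite ?inE// subrr normr0.
have x1 : 0 < `|x| + 1 by rewrite ltr_wpDl.
have e2 : 0 < e / 2 by rewrite divr_gt0.
have [t tP] := IH _ e2.
have [u uP] := scalar_totally_bounded hK (divr_gt0 e2 x1).
exists [seq b *: x + z | b <- u, z <- t] => _ [a a1 [y hy <-]].
have [b bu ab] := uP a a1; have [z zt yz] := tP y hy.
exists (b *: x + z); first by apply/allpairsP; exists (b, z).
rewrite opprD addrACA -scalerBl [e]splitr.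
apply: le_lt_trans (ler_normD _ _) _; rewrite ltrD// normrZ.
rewrite ltr_pdivlMr// in ab; apply: le_lt_trans ab.
by rewrite ler_wpM2l// lerDl.
Qed.

(** The open e/2-neighbourhood of [seq_hull s] is absolutely convex; once [s] is an e/2-net of [C]
    it contains [C], hence the hull. *)
Lemma abs_hull_totally_bounded (K : numFieldType) (hK : real_or_complex K)
  (X : normedModType K) (C : set X) :
  totally_bounded C -> totally_bounded (abs_hull C).
Proof.
move=> tC e e0; have e2 : 0 < e / 2 by rewrite divr_gt0.
have [s sP] := tC _ e2.
have [t tP] := seq_hull_totally_bounded hK s e2.
have [S0 SL] := seq_hull_abs_convex s.
exists t => x hx.
have [||y Sy xy] := hx [set x | exists2 y, seq_hull s y & `|x - y| < e / 2].
- split; first by exists 0; rewrite // subrr normr0.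
  move=> a b u v ab [y Sy uy] [z Sz vz]; exists (a *: y + b *: z); first exact: SL.
  rewrite opprD addrACA -!scalerBr; apply: le_lt_trans (ler_normD _ _) _.
  rewrite !normrZ.
  (* The strict inequality is drawn from the term of [a] if [a] is nonzero, and from that of [b]
     otherwise. *)
  have [->|a0] := eqVneq a 0.
    rewrite normr0 mul0r add0r; apply: le_lt_trans vz.
    by rewrite ler_piMl//; apply: le_trans ab; rewrite lerDr.
  apply: (@lt_le_trans _ _ ((`|a| + `|b|) * (e / 2))).
    by rewrite mulrDl ltr_leD// ?ltr_pM2l ?normr_gt0// ler_wpM2l// ltW.
  by rewrite ler_piMl// ltW.
- by move=> u /sP[y /mem_seq_hull ys uy]; exists y.
have [z zt yz] := tP y Sy; exists z => //.
rewrite (le_lt_trans (ler_distD y _ _))// [e]splitr.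
exact: ltrD.
Qed.

(** * Geometric convergence and bounds for continuous linear maps *)

Lemma geometric_limit (K : numFieldType) (hK : real_or_complex K)
    (X : completeNormedModType K) (a : nat -> X) (M : K) : 0 <= M ->
    (forall n, `|a n.+1 - a n| <= M * 2^-1 ^+ n) ->
  exists l, forall n, `|l - a n| <= 2 * M * 2^-1 ^+ n.
Proof.
move=> M0 aM.
have p0 n : 0 <= 2^-1 ^+ n :> K by rewrite exprn_ge0// invr_ge0.
have aD n k : `|a (n + k)%N - a n| <= 2 * M * 2^-1 ^+ n.
  (* The induction on [k] closes only for the exact partial sum of the geometric series. *)
  apply: (@le_trans _ _ (2 * M * (2^-1 ^+ n - 2^-1 ^+ (n + k)%N))); last first.
    by rewrite ler_wpM2l ?mulr_ge0// gerBl.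
  elim: k => [|k IH]; first by rewrite addn0 !subrr normr0 mulr0.
  rewrite addnS; apply: le_trans (ler_distD (a (n + k)%N) _ _) _.
  apply: le_trans (lerD (aM _) IH) _.
  by rewrite exprS le_eqVlt; apply/orP; left; apply/eqP; field.
have /cvg_ex[l al] : cvg (a @ \oo).
  apply: cauchy_cvg; apply: cauchy_exP => e e0.
  have M1 : 0 < 2 * M + 1 by rewrite ltr_wpDl// mulr_ge0.
  have [n] := half_expn_lt hK (divr_gt0 e0 M1).
  rewrite ltr_pdivlMr// => hn.
  exists (a n), n => // m /= nm; rewrite -ball_normE /= distrC.
  rewrite -(subnKC nm); apply: le_lt_trans (aD _ _) _.
  by apply: le_lt_trans hn; rewrite mulrC ler_wpM2l// lerDl.
exists l => n; apply/ler_addgt0Pr => e e0.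
have /cvgrPdist_lt/(_ _ e0)[m _ ml] := al.
have := ml (n + m)%N (leq_addl _ _) => /= lm.
rewrite (le_trans (ler_distD (a (n + m)%N) _ _))// addrC lerD//.
exact: ltW.
Qed.

Lemma linear_continuous_bound (K : numFieldType) (V W : normedModType K)
  (f : {linear V -> W}) :
  continuous f -> exists2 M, 0 < M & forall x, `|f x| <= M * `|x|.
Proof. by move=> /linear_bounded_continuous/linear_boundedP/pinfty_ex_gt0. Qed.

Lemma linear_bound_continuous (K : numFieldType) (V W : normedModType K)
  (f : {linear V -> W}) (M : K) :
  0 <= M -> (forall x, `|f x| <= M * `|x|) -> continuous f.
Proof.
move=> M0 fM; apply/linear_bounded_continuous/linear_boundedP.
exists M; split; first exact: ger0_real.
by move=> r Mr x; apply: le_trans (fM x) _; rewrite ler_wpM2r// ltW.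
Qed.

(** * Functionals and finite rank operators *)

Definition bounded_functional (K : numFieldType) (X : normedModType K) (f : X -> K) :=
  (forall a x y, f (a *: x + y) = a * f x + f y) /\
  exists2 M, 0 <= M & forall x, `|f x| <= M * `|x|.

Lemma bounded_functional_extension (K : numFieldType) (hK : real_or_complex K)
    (X : normedModType K) (F : X -> K -> Prop) (M : K) :
    0 <= M -> F 0 0 ->
    (forall a x s y t, F x s -> F y t -> F (a *: x + y) (a * s + t)) ->
    (forall x s, F x s -> `|s| <= M * `|x|) ->
  exists f : X -> K,
    [/\ (forall a x y, f (a *: x + y) = a * f x + f y),
        (forall x s, F x s -> f x = s) & forall x, `|f x| <= M * `|x|].
Proof.
move=> M0 F0 FL FM.
have [|||||f [fL fF fG]] :=
  @hahn_banach K hK X (fun x r => M * `|x| <= r) F _ _ _ _ F0 FL _.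
- by move=> x; exists (M * `|x|).
- by move=> x r; apply: le_trans; rewrite mulr_ge0.
- move=> x y r s xr ys; apply: le_trans (lerD xr ys).
  by rewrite -mulrDr ler_wpM2l// ler_normD.
- by move=> a x r xr; rewrite normrZ mulrCA ler_wpM2l.
- by move=> x s r /FM; apply: le_trans.
by exists f; split=> // x; apply: fG.
Qed.

Section Functional.
Variables (K : numFieldType) (X : normedModType K) (f : X -> K).
Hypothesis bf : bounded_functional f.

Lemma functional0 : f 0 = 0.
Proof. by have := bf.1 (-1) 0 0; rewrite scaler0 addr0 mulN1r addNr. Qed.

Lemma functionalD x y : f (x + y) = f x + f y.
Proof. by have := bf.1 1 x y; rewrite scale1r mul1r. Qed.

Lemma functionalZ a x : f (a *: x) = a * f x.
Proof. by have := bf.1 a x 0; rewrite !addr0 functional0 addr0. Qed.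

Lemma bounded_functional_comp (W : normedModType K) (T : {linear W -> X}) :
  continuous T -> bounded_functional (f \o T).
Proof.
move=> /linear_continuous_bound[M M0 TM]; split=> [a x y|] /=.
  by rewrite linearP functionalD functionalZ.
have [N N0 fN] := bf.2; exists (N * M); first by rewrite mulr_ge0// ltW.
by move=> x /=; rewrite -mulrA (le_trans (fN _))// ler_wpM2l.
Qed.

End Functional.

Lemma finite_rank_operator (K : numFieldType) (X Z : normedModType K) n
    (f : 'I_n -> X -> K) (v : 'I_n -> Z) :
    (forall j, bounded_functional (f j)) ->
  exists2 T : {linear X -> Z}, continuous T & forall x, T x = \sum_(j < n) f j x *: v j.
Proof.
move=> bf; have [|T TE] := @linear_pack K X Z (fun x => \sum_(j < n) f j x *: v j).
  move=> a x y; rewrite scaler_sumr -big_split; apply: eq_bigr => j _ /=.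
  by rewrite (bf j).1 scalerDl scalerA.
exists T => //.
have [M MP] := choice (fun j => let: ex_intro2 M M0 h := (bf j).2 in
  ex_intro (fun M => 0 <= M /\ forall x, `|f j x| <= M * `|x|) M (conj M0 h)).
apply: (@linear_bound_continuous _ _ _ _ (\sum_j M j * `|v j|)).
  by apply: sumr_ge0 => j _; rewrite mulr_ge0//; have [] := MP j.
move=> x; rewrite TE mulr_suml; apply: le_trans (ler_norm_sum _ _ _) _.
apply: ler_sum => j _; rewrite normrZ mulrAC ler_wpM2r//.
by have [_] := MP j.
Qed.

(** The family [v] may be dependent. By induction [P] fixes the span of the other vectors;
    [w = v0 - P v0] is the new direction, and a Hahn-Banach functional [eta] with value 1 at [w]
    reads off its coefficient. If [w] is 0, then [eta = 0] serves. *)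
Lemma lspan_coordinates (K : numFieldType) (hK : real_or_complex K)
    (X : normedModType K) n (v : 'I_n -> X) :
  exists2 f : 'I_n -> X -> K, (forall j, bounded_functional (f j)) &
    forall x, lspan v x -> x = \sum_(j < n) f j x *: v j.
Proof.
elim: n v => [|n IH] v.
  exists (fun _ _ => 0); first by case.
  by move=> x [c ->]; rewrite !big_ord0.
set v0 := v ord0; pose v' j := v (lift ord0 j).
have [f bf fE] := IH v'.
have [P cP PE] := finite_rank_operator v' bf.
pose w := v0 - P v0.
have [eta beta etaw] : exists2 eta, bounded_functional eta & eta w *: w = w.
  have [w0|w0] := eqVneq w 0.
    exists (fun=> 0); last by rewrite w0 scaler0.
    by split=> [a x y|]; [rewrite mulr0 addr0|exists 0 => // x; rewrite normr0 mul0r].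
  have nw : 0 < `|w| by rewrite normr_gt0.
  have [||||eta [etaL etaE etaM]] := @bounded_functional_extension K hK X
      (fun x s => x = s *: w) `|w|^-1.
  - by rewrite invr_ge0.
  - by rewrite scale0r.
  - by move=> a _ s _ t -> ->; rewrite scalerA scalerDl.
  - by move=> _ s ->; rewrite normrZ mulrCA mulVf ?mulr1// gt_eqF.
  exists eta; last by rewrite (etaE w 1) scale1r.
  by split=> //; exists `|w|^-1; rewrite // invr_ge0.
have [Q QE] : exists Q : {linear X -> X}, forall x, Q x = x - P x.
  apply: linear_pack => a x y; rewrite linearP scalerBr.
  by rewrite opprD addrACA.
have cQ : continuous Q.
  move=> x; rewrite (_ : Q = (fun x => x - P x) :> (_ -> _)); last exact/funext.
  by apply: cvgB => //; exact: cP.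
pose g0 := eta \o Q.
have bg0 : bounded_functional g0 by exact: bounded_functional_comp.
(* The old coordinates are corrected by those of [g0 x *: v0], so that the sum becomes
   [P x + g0 x *: w]. *)
pose g j := if unlift ord0 j is Some k then fun x => f k x - g0 x * f k v0 else g0.
exists g => [j|x [c xE]].
  rewrite /g; case: unliftP => [k _|_] //.
  have [M M0 fM] := (bf k).2; have [N N0 gN] := bg0.2.
  split=> [a x y|]; first by rewrite (bf k).1 bg0.1; ring.
  exists (M + N * `|f k v0|); first by rewrite addr_ge0// mulr_ge0.
  move=> x; apply: le_trans (ler_normB _ _) _.
  by rewrite mulrDl lerD// normrM mulrAC ler_wpM2r.
have -> : \sum_(j < n.+1) g j x *: v j = P x + g0 x *: w.
  rewrite big_ord_recl /g unlift_none.
  under eq_bigr do rewrite liftK scalerBl -scalerA.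
  rewrite sumrB -scaler_sumr -PE -PE /w scalerBr -/v0.
  by rewrite addrCA addrA.
have [y [ly xy]] : exists y, lspan v' y /\ x = c ord0 *: v0 + y.
  exists (\sum_(j < n) c (lift ord0 j) *: v' j); split; last by rewrite xE big_ord_recl.
  by exists (c \o lift ord0).
have Py : P y = y by rewrite PE -fE.
have Qv : Q v0 = w by rewrite QE.
have Qy : Q y = 0 by rewrite QE Py subrr.
rewrite xy (linearP P) Py /g0 /= (linearP Q) Qv Qy addr0.
rewrite (functionalZ beta) -scalerA etaw /w scalerBr.
by rewrite addrAC addrCA subrr addr0 -/v0.
Qed.

(** Elimination: either every element of [E] lies in the span of the vectors after the first, or
    some [e] in [E] has a nonzero first coefficient, and [E] is spanned by [e] together with its
    intersection with that smaller span. *)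
Lemma subspace_finite_dim (K : numFieldType) (X : lmodType K) n (v : 'I_n -> X)
    (E : set X) :
    E 0 -> (forall a x y, E x -> E y -> E (a *: x + y)) -> E `<=` lspan v ->
  finite_dim_subspace E.
Proof.
elim: n v E => [|n IH] v E E0 EL Ev.
  exists 0%N, v; apply/seteqP; split=> // x [c ->].
  by rewrite big_ord0.
pose v' j := v (lift ord0 j).
have lE (c : 'I_n.+1 -> K) : lspan v' (\sum_(j < n.+1) c j *: v j - c ord0 *: v ord0).
  by exists (c \o lift ord0); rewrite big_ord_recl addrAC subrr add0r.
have [[e [Ee [c [eE c0]]]]|none] := pselect (exists e, E e /\ exists c,
    e = \sum_(j < n.+1) c j *: v j /\ c ord0 != 0); last first.
  apply: (IH v') => // x Ex; have [c xE] := Ev x Ex.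
  have [c0|c0] := eqVneq (c ord0) 0.
    by have := lE c; rewrite -xE c0 scale0r subr0.
  by case: none; exists x; split=> //; exists c.
have [|||m [w wE]] := IH v' (E `&` lspan v') _ _ _.
- by split=> //; exists (fun=> 0); rewrite big1// => j _; rewrite scale0r.
- move=> a x y [Ex [d xE]] [Ey [d' yE]]; split; first exact: EL.
  exists (fun j => a * d j + d' j); rewrite xE yE scaler_sumr -big_split.
  by apply: eq_bigr => j _; rewrite scalerDl scalerA.
- by move=> x [].
exists m.+1, (fun j => if unlift ord0 j is Some k then w k else e).
have wS j : E (w j).
  suff : lspan w (w j) by rewrite -wE => -[].
  exists (fun k => (k == j)%:R).
  by rewrite (bigD1 j)//= eqxx scale1r big1 ?addr0// => k /negPf ->; rewrite scale0r.
apply/seteqP; split=> [x Ex|_ [d ->]].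
  have [d xE] := Ev x Ex; pose a := d ord0 / c ord0.
  have : (E `&` lspan v') ((- a) *: e + x).
    split; first exact: EL.
    have := lE (fun j => (- a) * c j + d j).
    rewrite [X in _ - X *: _](_ : _ = 0) ?scale0r ?subr0; last first.
      by rewrite mulNr /a divfK// addNr.
    by under eq_bigr do rewrite scalerDl -scalerA; rewrite big_split -scaler_sumr -eE -xE.
  rewrite wE => -[b bE].
  exists (fun j => if unlift ord0 j is Some k then b k else a).
  rewrite big_ord_recl unlift_none; under eq_bigr do rewrite liftK.
  by rewrite -bE scaleNr addNKr.
apply: (big_ind E) => // [x y Ex Ey|j _].
  by have := EL 1 _ _ Ex Ey; rewrite scale1r.
suff Ej : E (if unlift ord0 j is Some k then w k else e).
  by have := EL (d j) _ _ Ej E0; rewrite addr0.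
by case: unliftP.
Qed.

Lemma range_sub_finite_rank (K : numFieldType) (X : lmodType K) n (v : 'I_n -> X)
    (T : {linear X -> X}) :
  range T `<=` lspan v -> finite_rank T.
Proof.
apply: subspace_finite_dim; first by exists 0; rewrite ?linear0.
move=> a _ _ [x _ <-] [y _ <-]; exists (a *: x + y) => //.
by rewrite linearP.
Qed.

(** * Nets and approximation on compact sets *)

Lemma tails_filter (I : Type) (le : I -> I -> Prop) : directed le -> Filter (tails le).
Proof.
move=> [[i0] _ letr ledir]; split; first by exists i0.
- move=> A B [s As] [t Bt]; have [u [su tu]] := ledir s t.
  by exists u => w uw; split; [apply/As/(letr _ u)|apply/Bt/(letr _ u)].
- by move=> A B AB [s As]; exists s => t /As /AB.
Qed.

(** Nets are traded for single operators. Conversely, a net is indexed by the pairs of a compact set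
    and a tolerance, ordered by inclusion and by decreasing tolerance. *)
Lemma id_net_limitP (K : numFieldType) (X : normedModType K)
    (P : {linear X -> X} -> Prop) :
  id_net_limit P <->
  forall (C : set X) (e : K), compact C -> 0 < e ->
    exists T : {linear X -> X},
      [/\ continuous T, P T & forall x, C x -> `|T x - x| < e].
Proof.
split=> [[I [le [T [dir cT PT limT]]]] C e cC e0|H].
  have FF := tails_filter dir.
  have [s sP] := limT _ (@fam_nbhs _ _ compact C [set p : X * X | ball p.1 e p.2] id
    (@entourage_ball _ X (PosNum e0)) cC).
  exists (T s); split=> // x Cx.
  have [_ lexx _ _] := dir; have := sP s (lexx s) x Cx; rewrite /= -ball_normE /=.
  by rewrite distrC.
pose I := {p : set X * K | compact p.1 /\ 0 < p.2}.
pose le (p q : I) := (sval p).1 `<=` (sval q).1 /\ (sval q).2 <= (sval p).2.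
have mk C m : compact C -> 0 < m -> exists p : I, sval p = (C, m).
  move=> cC m0.
  by exists (@exist _ (fun p => compact p.1 /\ 0 < p.2) (C, m) (conj cC m0)).
have [T TP] := choice (fun p : I => H _ _ (proj1 (svalP p)) (proj2 (svalP p))).
have dir : directed le.
  split.
  + by have [p _] := mk set0 1 (@compact0 _) ltr01.
  + by move=> s; split.
  + move=> s t u [st1 st2] [tu1 tu2]; split; first exact: subset_trans tu1.
    exact: le_trans st2.
  + move=> [[C c] [cC c0]] [[D d] [cD d0]].
    (* The order of a complex [K] is partial; the tolerances are comparable because positive
       elements are real. *)
    have /orP cd : (c <= d) || (d <= c) by apply: real_leVge; exact: gtr0_real.
    have mn : exists m, [/\ 0 < m, m <= c & m <= d].
      by case: cd => h; [exists c|exists d].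
    have [m [m0 mc md]] := mn.
    have [p pE] := mk _ _ (compactU cC cD) m0.
    by exists p; rewrite /le pE; split; split=> //=.
have FF := tails_filter dir.
exists I, le, T; split=> //; first by move=> t; have [] := TP t.
  by move=> t; have [] := TP t.
apply/fam_cvgP => C cC U; rewrite uniform_nbhs => -[E [entE EU]].
  move: entE; rewrite -entourage_ballE => -[e /= e0 eE].
  have [p pE] := mk _ _ cC e0.
  exists p => t; rewrite /le pE => -[/= Ct te]; apply: EU => x Cx.
  apply: eE => /=; rewrite -ball_normE /= distrC.
  have [_ _ h] := TP t.
  by apply: lt_le_trans te; apply/h/Ct.
Qed.

(** * Extension of functionals with small values on a compact set *)

Lemma totally_bounded_norm (K : numFieldType) (X : normedModType K) (A : set X) :
  totally_bounded A -> exists2 B, 0 <= B & forall x, A x -> `|x| <= B.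
Proof.
move=> /(_ 1 ltr01)[s sA]; exists (1 + \sum_(y <- s) `|y|).
  by rewrite addr_ge0// sumr_ge0.
move=> x /sA[y ys xy]; rewrite -[x](subrK y).
rewrite (le_trans (ler_normD _ _))// lerD ?(ltW xy)//.
by rewrite (big_rem _ ys)/= lerDl sumr_ge0.
Qed.

Section SmallExtension.
Variables (K : numFieldType) (X : normedModType K) (F : X -> K -> Prop) (M : K).
Hypotheses (hK : real_or_complex K) (M0 : 0 <= M).
Hypothesis F0 : F 0 0.
Hypothesis FL : forall a x s y t, F x s -> F y t -> F (a *: x + y) (a * s + t).
Hypothesis FM : forall x s, F x s -> `|s| <= M * `|x|.
Hypothesis F_closed : closed [set x | exists s, F x s].

(** Around a point of [D] in the domain of [F], the Lipschitz bound [FM] costs at most another [d];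
    around any other point a ball misses the closed domain. Compactness makes the radius uniform. *)
Lemma small_near_compact (D : set X) (d : K) : compact D -> 0 < d ->
    (forall x s, F x s -> D x -> `|s| <= d) ->
  exists2 b, 0 < b & forall c x s, D c -> F x s -> `|x - c| < b -> `|s| <= 2 * d.
Proof.
move=> cD d0 Fd.
have local c : D c -> exists2 e, 0 < e &
    forall x s, F x s -> `|x - c| < e -> `|s| <= 2 * d.
  move=> Dc; have [[t Ft]|nc] := pselect (exists t, F c t).
    have M1 : 0 < M + 1 by rewrite ltr_wpDl.
    exists (d / (M + 1)); first by rewrite divr_gt0.
    move=> x s Fs; rewrite ltr_pdivlMr// => xc.
    have Fst : F (x - c) (s - t).
      by have := FL (-1) Ft Fs; rewrite scaleN1r mulN1r addrC [- t + s]addrC.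
    rewrite -[s](subrK t) mulrDl mul1r (le_trans (ler_normD _ _))// lerD//; last first.
      exact: Fd Ft Dc.
    apply: le_trans (FM Fst) _; apply: le_trans (ltW xc).
    by rewrite mulrC ler_wpM2l// lerDl.
  have : nbhs c (~` [set x | exists s, F x s]).
    by apply: open_nbhs_nbhs; split=> //; exact: closed_openC.
  move=> /nbhs_ballP[e /= e0 eF]; exists e => // x s Fs xc.
  by case: (eF x); [rewrite -ball_normE /= distrC|exists s].
have p0 n : 0 <= 2^-1 ^+ n :> K by rewrite exprn_ge0// invr_ge0.
have /compact_near_coveringP cov := cD.
have [] := cov nat \oo (fun n c => forall x s, F x s -> `|x - c| < 2^-1 ^+ n ->
  `|s| <= 2 * d) _.
  move=> c Dc; have [e e0 eP] := local c Dc.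
  have e2 : 0 < e / 2 by rewrite divr_gt0.
  have [N hN] := half_expn_lt hK e2.
  exists (ball c (e / 2), [set n | (N <= n)%N]).
    by split; [exact: nbhsx_ballx|exists N].
  move=> [c' n] [/=]; rewrite -ball_normE /= => cc' Nn x s Fs xc'.
  apply: eP Fs _; rewrite (le_lt_trans (ler_distD c' _ _))// [e]splitr ltrD//.
    apply: lt_trans hN; apply: lt_le_trans xc' _.
    by rewrite ler_wiXn2l// ?invr_ge0// invf_le1// ler1n.
  by rewrite distrC.
move=> N _ /(_ N (leqnn N)) NP; exists (2^-1 ^+ N); first by rewrite exprn_gt0 ?invr_gt0.
by move=> c x s Dc; exact: NP Dc x s.
Qed.

(** Hahn-Banach for the largest seminorm below both [2 * d] times the gauge of [H] and a large
    multiple of the norm; [G] encodes it through decompositions of [x]. *)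
Lemma small_extension (H : set X) (d : K) : abs_convex H -> totally_bounded H ->
    compact (closure H) -> 0 < d ->
    (forall x s, F x s -> closure H x -> `|s| <= d) ->
  exists f, [/\ bounded_functional f, (forall x s, F x s -> f x = s) &
    forall x, H x -> `|f x| <= 2 * d].
Proof.
move=> [H0 HL] tH cH d0 Fd.
have [b b0 bP] := small_near_compact cH d0 Fd.
have [B B0 HB] := totally_bounded_norm tH.
(* If the norm of [w] is at least [b * |a|], then [a *: h + w] has norm at most
   [(B / b + 1) * |w|]. *)
pose M' := M * (B / b + 1).
have M'0 : 0 <= M' by rewrite mulr_ge0// addr_ge0// divr_ge0// ltW.
have d2 : 0 <= 2 * d by rewrite mulr_ge0// ltW.
(* The points of F lying b-close to H have small values by [bP], the others are
   controlled by the norm of w. *)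
pose G x r := exists a h w, [/\ H h, x = a *: h + w & 2 * d * `|a| + M' * `|w| <= r].
have Gx x : G x (M' * `|x|).
  by exists 0, 0, x; rewrite scale0r add0r normr0 mulr0 add0r.
have [|||||f [fL fF fG]] := @hahn_banach K hK X G F _ _ _ _ F0 FL _.
- by move=> x; exists (M' * `|x|).
- by move=> x r [a [h [w [_ _]]]]; apply: le_trans; rewrite addr_ge0// mulr_ge0.
- move=> _ _ r r' [a [h [w [Hh -> hr]]]] [a' [h' [w' [Hh' -> hr']]]].
  (* Normalising by [c] puts the combination back into [H]. If [c] is 0, both coefficients vanish
     and division by zero gives 0. *)
  pose c := `|a| + `|a'|.
  have c0 : 0 <= c by rewrite addr_ge0.
  exists c, ((a / c) *: h + (a' / c) *: h'), (w + w'); split.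
  + apply: HL => //; rewrite !normrM -mulrDl normfV (ger0_norm c0).
    by have [->|cn] := eqVneq c 0; [rewrite invr0 mulr0 ler01|rewrite divff].
  + rewrite scalerDr !scalerA addrACA; congr (_ + _).
    have [c00|cn] := eqVneq c 0; last by rewrite ![c * _]mulrC !divfK.
    have := c00; move/eqP; rewrite paddr_eq0// !normr_eq0 => /andP[/eqP -> /eqP ->].
    by rewrite !mul0r !mulr0.
  + apply: le_trans (lerD hr hr'); rewrite (ger0_norm c0) addrACA -!mulrDr lerD2l.
    by rewrite ler_wpM2l// ler_normD.
- move=> a _ r [c [h [w [Hh -> hr]]]]; exists (a * c), h, (a *: w); split=> //.
    by rewrite scalerDr scalerA.
  rewrite normrM normrZ !(mulrCA _ `|a|) -mulrDr.
  by rewrite ler_wpM2l.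
- move=> x s r Fs [a [h [w [Hh xE]]]]; apply: le_trans.
  have rb : b * `|a| \is Num.real by rewrite realM// gtr0_real.
  have [wa|aw] := real_ltP (normr_real w) rb.
    have a0 : 0 < `|a| by rewrite -(pmulr_rgt0 _ b0); apply: le_lt_trans wa.
    have an : a != 0 by rewrite -normr_gt0.
    have Fas : F (a^-1 *: x) (a^-1 * s) by have := FL a^-1 Fs F0; rewrite !addr0.
    have : `|a^-1 * s| <= 2 * d.
      apply: (bP h) Fas _; first exact: subset_closure.
      rewrite xE scalerDr scalerA mulVf// scale1r addrAC subrr add0r.
      by rewrite normrZ normfV mulrC ltr_pdivrMr.
    rewrite normrM normfV mulrC ler_pdivrMr// => sa.
    by apply: le_trans sa _; rewrite lerDl mulr_ge0.
  apply: le_trans (FM Fs) _; rewrite -[leLHS]add0r lerD ?(mulr_ge0 d2)//.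
  rewrite /M' -mulrA ler_wpM2l// xE mulrDl mul1r.
  rewrite (le_trans (ler_normD _ _))// lerD// normrZ.
  rewrite mulrAC ler_pdivlMr// [leLHS]mulrAC [leRHS]mulrC.
  by rewrite ler_pM ?HB ?(mulrC _ b) ?mulr_ge0 ?(ltW b0).
exists f; split=> //; first by split=> //; exists M' => // x; apply/fG/Gx.
move=> x Hx; apply: fG; exists 1, x, 0; split=> //; first by rewrite scale1r addr0.
by rewrite normr1 normr0 mulr1 mulr0 addr0.
Qed.

End SmallExtension.

(** * The pair (X, Y) *)

Lemma norm_coord_le (K : numFieldType) n (u : 'rV[K]_n) j : `|u 0 j| <= `|u|.
Proof.
rewrite [leRHS]mx_normE -[leLHS]nngE num_le.
exact: (le_bigmax _ (fun i : 'I_1 * 'I_n => `|u i.1 i.2|%:nng) (0, j)).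
Qed.

Lemma norm_row_le (K : numFieldType) n (u : 'rV[K]_n) (r : K) :
  0 <= r -> (forall j, `|u 0 j| <= r) -> `|u| <= r.
Proof.
move=> r0 ur; have [->|u0] := eqVneq `|u| 0; first by [].
have [[k j] /= uE] := mx_norm_neq0 u0.
by rewrite -[leLHS]/(mx_norm u) uE (ord1 k).
Qed.

Lemma sum_scale_delta (K : numFieldType) (X : lmodType K) n
    (T : {linear 'rV[K]_n -> X}) (c : 'I_n -> K) :
  \sum_(j < n) c j *: T (delta_mx 0 j) = T (\row_j c j).
Proof.
rewrite [\row_j c j]row_sum_delta linear_sum; apply: eq_bigr => j _.
by rewrite linearZ mxE.
Qed.

Lemma Linfty_frame (K : numFieldType) (X : normedModType K) : Linfty_space X ->
  exists2 mu : K, 0 < mu & forall E : set X, finite_dim_subspace E ->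
    exists n (T : {linear 'rV[K]_n -> X}) (a b : K),
      [/\ E `<=` range T, 0 <= a, 0 < b /\ a * b <= mu,
          (forall v, `|T v| <= a * `|v|) & (forall v, `|v| <= b * `|T v|)].
Proof.
move=> [la la0 H]; exists (la + 2); first by rewrite ltr_wpDl.
move=> E fE; have [F [_ EF [n bm]]] := H E fE.
have [_ [T [a [b [_ rT [a0 b0] [Ta Tb] ->]]]] ab] := bm (la + 1) ltac:(by rewrite ltrDl).
have a1 : 0 < a + 1 by rewrite ltr_wpDl.
(* Enlarging [b] makes it strictly positive and raises [a * b] by at most 1; another 1 is the slack
   in the Banach-Mazur infimum. *)
exists n, T, a, (b + (a + 1)^-1); split=> //; first by rewrite rT.
  split; first by rewrite ltr_wpDl// invr_gt0.
  rewrite mulrDr -[2]/(1 + 1) addrA lerD// ?(ltW ab)//.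
  by rewrite ler_pdivrMr// mul1r lerDl.
by move=> v; rewrite mulrDl; apply: le_trans (Tb v) _; rewrite lerDl mulr_ge0// invr_ge0 ltW.
Qed.

Section Embedding.
Variables (K : numFieldType) (hK : real_or_complex K).
Variables (Y X : normedModType K) (i : {linear Y -> X}) (c : K).
Hypotheses (c0 : 0 < c) (ic : forall y, c * `|y| <= `|i y|).

(** The image filter clusters at some [i y], and the lower bound [ic] carries the clustering back to
    [y]. *)
Lemma embedding_preimage_compact (D : set X) :
  compact D -> D `<=` range i -> compact (i @^-1` D).
Proof.
move=> cD Di F FF FD.
have [l [Dl cl]] := cD (i @ F) _ FD.
have [y _ yl] := Di l Dl.
exists y; split; first by rewrite /preimage /= yl.
move=> A B FA /nbhs_ballP[e /= e0 eB].
have FiA : (i @ F) (i @` A) by apply: (@filterS _ F _ A) => // z Az; exists z.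
have [_ [[z Az <-] lz]] := cl _ _ FiA (nbhsx_ballx l _ (mulr_gt0 c0 e0)).
exists z; split=> //; apply: eB.
move: lz; rewrite -!ball_normE /= -yl -linearB => h.
by rewrite -(ltr_pM2l c0); apply: le_lt_trans h; apply: ic.
Qed.

Lemma functional_extension (f : Y -> K) : bounded_functional f ->
  exists2 g : X -> K, bounded_functional g & forall y, g (i y) = f y.
Proof.
move=> bf; have [M M0 fM] := bf.2.
have [||||g [gL gF gM]] := @bounded_functional_extension K hK X
  (fun x s => exists2 y, x = i y & s = f y) (M / c).
- by rewrite divr_ge0// ltW.
- by exists 0; rewrite ?linear0 ?(functional0 bf).
- by move=> a _ _ _ _ [y -> ->] [z -> ->]; exists (a *: y + z); rewrite ?linearP ?bf.1.
- move=> _ _ [y -> ->]; apply: le_trans (fM y) _.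
  by rewrite -mulrA ler_wpM2l// mulrC ler_pdivlMr// mulrC ic.
exists g; last by move=> y; apply: gF; exists y.
by split=> //; exists (M / c); rewrite // divr_ge0// ltW.
Qed.

(** In coordinates on its range [A] is a finite sum of functionals times vectors; each functional is
    extended to [X]. *)
Lemma finite_rank_extension (A : {linear Y -> Y}) : continuous A -> finite_rank A ->
  exists n (v : 'I_n -> Y) (B : {linear X -> X}),
    [/\ continuous B, (forall x, lspan (i \o v) (B x)) & forall y, B (i y) = i (A y)].
Proof.
move=> cA [n [v Av]]; have [f bf fE] := lspan_coordinates hK v.
have bfA j : bounded_functional (f j \o A) by exact: bounded_functional_comp.
have [g gP] := choice (fun j => let: ex_intro2 g bg gE := functional_extension (bfA j) in
  ex_intro (fun g => bounded_functional g /\ forall y, g (i y) = f j (A y)) g (conj bg gE)).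
have [B cB BE] := finite_rank_operator (i \o v) (fun j => (gP j).1).
exists n, v, B; split=> // [x|y]; first by exists (fun j => g j x); rewrite BE.
rewrite BE [A y in RHS]fE; last by rewrite -Av; exists y.
rewrite linear_sum; apply: eq_bigr => j _.
by rewrite (gP j).2 linearZ.
Qed.

End Embedding.

Lemma lspan_cat (K : numFieldType) (X : lmodType K) m n (v : 'I_m -> X)
    (w : 'I_n -> X) :
  exists u : 'I_(m + n) -> X, forall x y, lspan v x -> lspan w y -> lspan u (x + y).
Proof.
exists (fun k : 'I_(m + n) => match fintype.split k with inl j => v j | inr j => w j end).
move=> _ _ [a ->] [b ->].
exists (fun k : 'I_(m + n) => match fintype.split k with inl j => a j | inr j => b j end).
rewrite big_split_ord; congr (_ + _); apply: eq_bigr => j _.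
  by rewrite -[lshift n _]/(unsplit (inl j)) unsplitK.
by rewrite -[rshift m _]/(unsplit (inr j)) unsplitK.
Qed.

Lemma pair_ap_of_ap (K : numFieldType) (hK : real_or_complex K)
    (Y : normedModType K) (X : completeNormedModType K) (i : {linear Y -> X}) (c : K) :
    continuous i -> 0 < c -> (forall y, c * `|y| <= `|i y|) -> closed (range i) ->
    Linfty_space X -> approximation_property Y ->
  pair_approximation_property (range i).
Proof.
move=> ci c0 ic clY LX /id_net_limitP apY; apply/id_net_limitP => C e cC e0.
have [mu mu0 frame] := Linfty_frame LX.
have [Mi Mi0 iM] := linear_continuous_bound ci.
have tH := abs_hull_totally_bounded hK (compact_totally_bounded cC).
have cH := totally_bounded_closure tH.
set H := abs_hull C in tH cH.
(* Chosen so that the final correction [S] is at most [2 * mu * dl = e / 4] on [C]. *)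
pose dl := e / (8 * mu).
have dl0 : 0 < dl by rewrite divr_gt0// mulr_gt0.
(* [A] is made close to the identity on the trace of the closed hull, not only of [C], as
   [small_extension] requires. *)
have cD : compact (i @^-1` (closure H `&` range i)).
  apply: (embedding_preimage_compact c0 ic); last by move=> x [].
  apply: (subclosed_compact _ cH); last by move=> x [].
  by apply: closedI => //; exact: closed_closure.
have [A [cA fA AD]] := apY _ _ cD (divr_gt0 dl0 Mi0).
have {}AD y : closure H (i y) -> `|i y - i (A y)| <= dl.
  move=> Hy; rewrite -linearB; apply: le_trans (iM _) _.
  by rewrite mulrC -ler_pdivlMr// distrC; apply/ltW/AD; split=> //; exists y.
have [m [v [B [cB Bv BA]]]] := finite_rank_extension hK c0 ic cA fA.
have [R RE] : exists R : {linear X -> X}, forall x, R x = x - B x.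
  by apply: linear_pack => a x y; rewrite linearP scalerBr opprD addrACA.
have cR : continuous R.
  move=> x; rewrite (_ : R = (fun x => x - B x) :> (_ -> _)); last exact/funext.
  by apply: cvgB => //; exact: cB.
(* [P - 1] will vanish on the range of [T] and have norm at most [1 + mu], so an [eta]-net of the
   image of [C] under [R] inside that range gives an error below [e / 2]. *)
pose eta := e / (2 * (1 + mu)).
have mu1 : 0 < 1 + mu by rewrite addr_gt0.
have eta0 : 0 < eta by rewrite divr_gt0// mulr_gt0.
have [s sP] := compact_totally_bounded
  (continuous_compact (continuous_subspaceT cR) cC) eta0.
have [n [T [a [b [ET a0 [b0 ab] Ta Tb]]]]] :=
  frame (lspan (fun j : 'I_(size s) => s`_j)) (ex_intro _ _ (ex_intro _ _ erefl)).
have sT z : z \in s -> exists u, T u = z.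
  move=> zs; suff /ET[u _ uz] : lspan (fun j : 'I_(size s) => s`_j) z by exists u.
  have zi : (index z s < size s)%N by rewrite index_mem.
  exists (fun j => (j == Ordinal zi)%:R).
  rewrite (bigD1 (Ordinal zi))//= eqxx scale1r nth_index// big1 ?addr0//.
  by move=> j /negPf ->; rewrite scale0r.
pose t j := T (delta_mx 0 j).
(* The coordinates of the inverse of [T] are extended one by one, each with bound [b]. As the row
   space has the supremum norm, the resulting projection [P] has norm at most [a * b], whatever [n]
   is. *)
have gex j : exists g : X -> K, bounded_functional g /\
    (forall x, `|g x| <= b * `|x|) /\ forall u, g (T u) = u 0 j.
  have [||||g [gL gF gM]] := @bounded_functional_extension K hK X
    (fun x r => exists2 u, x = T u & r = u 0 j) b.
  - exact: ltW.
  - by exists 0; rewrite ?linear0 ?mxE.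
  - move=> k _ _ _ _ [u -> ->] [w -> ->].
    by exists (k *: u + w); rewrite ?linearP// !mxE.
  - by move=> _ _ [u -> ->]; apply: le_trans (norm_coord_le _ _) (Tb u).
  exists g; split; first by split=> //; exists b => //; exact: ltW.
  by split=> // u; apply: gF; exists u.
have [g gP] := choice gex.
have bg j : bounded_functional (g j) by have [] := gP j.
have gM j x : `|g j x| <= b * `|x| by have [_ []] := gP j.
have gT j u : g j (T u) = u 0 j by have [_ []] := gP j.
have [P cP PE] := finite_rank_operator t bg.
have PT u : P (T u) = T u.
  rewrite PE (sum_scale_delta T) (_ : \row_j _ = u)//.
  by apply/rowP => j; rewrite mxE gT.
have PM x : `|P x| <= mu * `|x|.
  rewrite PE (sum_scale_delta T) (le_trans (Ta _))//.
  apply: (@le_trans _ _ (a * (b * `|x|))).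
    rewrite ler_wpM2l// norm_row_le// => [|j]; first by rewrite mulr_ge0// ltW.
    by rewrite mxE.
  by rewrite mulrA ler_wpM2r.
have [ME ME0 EM] : exists2 M, 0 <= M & forall y, `|y - A y| <= M * `|y|.
  have [M M0 AM] := linear_continuous_bound cA; exists (1 + M).
    by rewrite addr_ge0// ltW.
  by move=> y; rewrite mulrDl mul1r (le_trans (ler_normB _ _))// lerD.
(* On [Y] these functionals are the coordinates of [P (1 - A)], so [S] will cancel that term there
   while staying small on [C]. *)
have hex j : exists h : X -> K, [/\ bounded_functional h,
    (forall y, h (i y) = g j (i y - i (A y))) & forall x, H x -> `|h x| <= 2 * (b * dl)].
  have [||||||||||h [bh hF hH]] := @small_extension K X
    (fun x r => exists2 y, x = i y & r = g j (i y - i (A y))) (b * (Mi * (ME / c)))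
    hK _ _ _ _ _ H (b * dl).
  - by rewrite !mulr_ge0// ?ltW// invr_gt0.
  - by exists 0; rewrite ?(linear0 A) (linear0 i) ?subrr ?(functional0 (bg j)).
  - move=> k _ _ _ _ [y -> ->] [z -> ->]; exists (k *: y + z); first by rewrite linearP.
    rewrite -(bg j).1; congr (g j _).
    by rewrite (linearP A) !(linearP i) scalerBr opprD addrACA.
  - move=> _ _ [y -> ->]; apply: le_trans (gM _ _) _.
    rewrite -mulrA ler_wpM2l ?(ltW b0)// -linearB (le_trans (iM _))// -!mulrA.
    rewrite ler_wpM2l ?(ltW Mi0)// (le_trans (EM _))// ler_wpM2l//.
    by rewrite mulrC ler_pdivlMr// mulrC ic.
  - rewrite (_ : mkset _ = range i)//; apply/seteqP; split=> [x [_ [y -> _]]|x [y _ <-]].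
      by exists y.
    by exists (g j (i y - i (A y))), y.
  - exact: abs_hull_abs_convex.
  - exact: tH.
  - exact: cH.
  - exact: mulr_gt0.
  - move=> _ _ [y -> ->] Hy; apply: le_trans (gM _ _) _.
    by rewrite ler_wpM2l ?(ltW b0)// AD.
  by exists h; split=> // y; apply: hF; exists y.
have [h hP] := choice hex.
have bh j : bounded_functional (h j) by have [] := hP j.
have [S cS SE] := finite_rank_operator t bh.
have [L LE] : exists L : {linear X -> X}, forall x, L x = B x + P (R x) - S x.
  apply: linear_pack => k x y; rewrite (linearP R) (linearP B) (linearP P) (linearP S).
  by rewrite scalerBr scalerDr opprD [RHS]addrACA; congr (_ + _); rewrite addrACA.
exists L; split.
- move=> x; rewrite (_ : L = (fun x => B x + P (R x) - S x) :> (_ -> _)); last exact/funext.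
  apply: cvgB; last exact: cS.
  apply: cvgD; first exact: cB.
  by apply: continuous_comp; [exact: cR|exact: cP].
- split.
    have [w wP] := lspan_cat (i \o v) t.
    apply: (@range_sub_finite_rank _ _ _ w) => _ [x _ <-].
    rewrite LE -addrA; apply: wP => //.
    exists (fun j => g j (R x) - h j x); rewrite PE SE -sumrB.
    by apply: eq_bigr => j _; rewrite scalerBl.
  move=> _ [y _ <-]; exists (A y) => //.
  rewrite LE BA RE BA PE SE (eq_bigr (fun j => h j (i y) *: t j)) ?addrK// => j _.
  by have [_ -> _] := hP j.
- move=> x Cx.
  have Hx : H x by exact: sub_abs_hull.
  (* Since [R = 1 - B], the uncontrolled [B] disappears from the error. *)
  have -> : L x - x = (P (R x) - R x) - S x.
    rewrite LE; set p := P (R x); rewrite (RE x) opprB addrAC.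
    by rewrite addrA (addrC p).
  have e2 : `|S x| <= e / 4.
    rewrite SE (sum_scale_delta T) (le_trans (Ta _))//.
    apply: (@le_trans _ _ (a * (2 * (b * dl)))).
      have d2 : 0 <= 2 * (b * dl) by apply: mulr_ge0 => //; apply: mulr_ge0; apply: ltW.
      rewrite ler_wpM2l// norm_row_le// => j.
      by rewrite mxE; have [_ _] := hP j; apply.
    apply: (@le_trans _ _ (2 * mu * dl)).
      by rewrite mulrCA -mulrA ler_wpM2l// mulrA ler_wpM2r// ltW.
    rewrite /dl le_eqVlt; apply/orP; left; apply/eqP; field.
    by rewrite gt_eqF.
  have [z zs Rz] := sP (R x) (ex_intro2 _ _ x Cx erefl).
  have [u uz] := sT z zs.
  have Pz : P z = z by rewrite -uz PT.
  have e1 : `|P (R x) - R x| < e / 2.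
    have -> : P (R x) - R x = P (R x - z) - (R x - z).
      by rewrite linearB /= Pz opprB addrA subrK.
    apply: le_lt_trans (ler_normB _ _) _.
    apply: (@le_lt_trans _ _ ((1 + mu) * `|R x - z|)).
      by rewrite mulrDl mul1r addrC lerD2l.
    rewrite mulrC -ltr_pdivlMr//; apply: lt_le_trans Rz _.
    by rewrite /eta invfM mulrA.
  apply: le_lt_trans (ler_normB _ _) _.
  rewrite [e]splitr ltr_leD// (le_trans e2)// ler_wpM2l ?(ltW e0)//.
  by rewrite lef_pV2 ?posrE// ler_nat.
Qed.

(** * Open mapping theorem and quotients *)

Lemma eq0_half_expn (K : numFieldType) (hK : real_or_complex K) (X : normedModType K)
    (x : X) (M : K) :
  0 <= M -> (forall n, `|x| <= M * 2^-1 ^+ n) -> x = 0.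
Proof.
move=> M0 xM; apply/eqP; rewrite -normr_le0; apply/ler_addgt0Pr => e e0; rewrite add0r.
have M1 : 0 < M + 1 by rewrite ltr_wpDl.
have [n] := half_expn_lt hK (divr_gt0 e0 M1); rewrite ltr_pdivlMr// => hn.
apply: le_trans (xM n) _; apply: le_trans (ltW hn).
by rewrite mulrC ler_wpM2l ?lerDl// exprn_ge0// invr_ge0.
Qed.

(** The balls are nested with radii at most [2^-1 ^+ n], so their centres converge to a point of all
    the closed balls; the ball of index [n.+1] avoids [A n]. *)
Lemma baire_nested_balls (K : numFieldType) (hK : real_or_complex K)
    (Z : completeNormedModType K) (A : nat -> set Z) :
    (forall n z r, 0 < r -> exists z' r', [/\ 0 < r', r' <= r / 2, `|z' - z| + r' <= r &
      forall w, `|w - z'| <= r' -> ~ A n w]) ->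
  exists z, forall n, ~ A n z.
Proof.
move=> H.
have next (p : nat * (Z * K)) : exists p' : Z * K, 0 < p.2.2 ->
    [/\ 0 < p'.2, p'.2 <= p.2.2 / 2, `|p'.1 - p.2.1| + p'.2 <= p.2.2 &
      forall w, `|w - p'.1| <= p'.2 -> ~ A p.1 w].
  case: p => n [z r] /=.
  have [r0|nr] := boolP (0 < r); last by exists (z, r).
  by have [z' [r' h]] := H n z r r0; exists (z', r').
have [f fP] := choice next.
pose fix u n : Z * K := if n is m.+1 then f (m, u m) else (0, 1).
have u0 n : 0 < (u n).2 by elim: n => [|n IH]; [exact: ltr01|have [] := fP (n, u n) IH].
have uS n : [/\ (u n.+1).2 <= (u n).2 / 2, `|(u n.+1).1 - (u n).1| + (u n.+1).2 <= (u n).2 &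
    forall w, `|w - (u n.+1).1| <= (u n.+1).2 -> ~ A n w].
  by have [] := fP (n, u n) (u0 n).
have u2 n : (u n).2 <= 2^-1 ^+ n.
  elim: n => [|n IH]; first by rewrite expr0.
  have [h _ _] := uS n; apply: le_trans h _.
  by rewrite exprSr ler_wpM2r// invr_ge0.
have [n|l lP] := @geometric_limit K hK Z (fun n => (u n).1) 1 ler01.
  have [_ h _] := uS n; rewrite mul1r; apply: le_trans (u2 n).
  by apply: le_trans h; rewrite lerDl ltW.
suff ul n : `|l - (u n).1| <= (u n).2.
    by exists l => n; have [_ _] := uS n; apply.
  have um k : `|(u (n + k)%N).1 - (u n).1| + (u (n + k)%N).2 <= (u n).2.
    elim: k => [|k IH]; first by rewrite addn0 subrr normr0 add0r.
    rewrite addnS; apply: le_trans IH; have [_ h _] := uS (n + k)%N.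
    apply: le_trans (lerD (ler_distD (u (n + k)%N).1 _ _) (lexx _)) _.
    by rewrite addrAC [leRHS]addrC lerD2r.
  apply/ler_addgt0Pr => e e0.
  have [k hk] := half_expn_lt hK (divr_gt0 e0 (ltr0Sn K 1)).
  apply: le_trans (ler_distD (u (n + k)%N).1 _ _) _; rewrite addrC lerD//.
    by apply: le_trans (um k); rewrite lerDl ltW.
  apply: le_trans (lP _) _; rewrite ltr_pdivlMr// in hk.
  apply: le_trans (ltW hk); rewrite mulr1 mulrC ler_wpM2r//.
  by rewrite ler_wiXn2l ?leq_addl// ?invr_ge0// invf_le1// ler1n.
Qed.

Section OpenMapping.
Variables (K : numFieldType) (hK : real_or_complex K).
Variables (X Z : completeNormedModType K) (q : {linear X -> Z}).
Hypotheses (cq : continuous q) (sq : forall z, exists x, q x = z).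

(** The sets [A n], images of the balls of radius [2 ^+ n], cover [Z]; by Baire one of them meets
    every small enough ball inside some ball. Differences move this to the origin, and scaling does
    the rest. *)
Lemma almost_open : exists2 k, 0 <= k & forall z, exists x,
  `|x| <= k * `|z| /\ `|z - q x| <= 2^-1 * `|z|.
Proof.
have p0 n : 0 < 2^-1 ^+ n :> K by rewrite exprn_gt0// invr_gt0.
pose A n : set Z := [set q x | x in [set x | `|x| * 2^-1 ^+ n <= 1]].
have [n [z [r [r0 hr]]]] : exists n z r, 0 < r /\ forall z' r', 0 < r' -> r' <= r / 2 ->
    `|z' - z| + r' <= r -> exists w, `|w - z'| <= r' /\ A n w.
  apply: contrapT => no.
  have [n z r r0|z zA] := @baire_nested_balls K hK Z A.
    apply: contrapT => no'; apply: no; exists n, z, r; split=> // z' r' r'0 r'r zr.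
    apply: contrapT => no''; apply: no'; exists z', r'; split=> // w wz Aw.
    by apply: no''; exists w.
  have [x qx] := sq z.
  have x1 : 0 < `|x| + 1 by rewrite ltr_wpDl.
  have [n hn] := half_expn_lt hK (divr_gt0 ltr01 x1).
  apply: (zA n); exists x => //=; rewrite ltr_pdivlMr// in hn.
  by apply: le_trans (ltW hn); rewrite mulrC ler_wpM2l ?lerDl// ltW.
pose N : K := 2 / 2^-1 ^+ n.
have N0 : 0 <= N by rewrite divr_ge0// ltW.
have r2 : 0 < r / 2 by rewrite divr_gt0.
have r8 : 0 < r / 8 by rewrite divr_gt0.
have r82 : r / 8 <= r / 2 by rewrite ler_wpM2l ?(ltW r0)// lef_pV2 ?posrE// ler_nat.
(* Write [u] as [(z + u) - z] and approximate both terms within [r / 8]. *)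
have step u : `|u| <= r / 2 -> exists x, `|x| <= N /\ `|u - q x| <= r / 4.
  move=> ur.
  have [|w1 [h1 [x1 /= hx1 q1]]] := hr (z + u) (r / 8) r8 r82.
    by rewrite addrAC subrr add0r [leRHS]splitr lerD.
  have [|w2 [h2 [x2 /= hx2 q2]]] := hr z (r / 8) r8 r82.
    by rewrite subrr normr0 add0r (le_trans r82)// ler_piMr ?ltW// invf_lt1// ltr1n.
  exists (x1 - x2); split.
    apply: le_trans (ler_normB _ _) _; rewrite /N -[2]/(1 + 1) mulrDl.
    by rewrite lerD// ler_pdivlMr.
  have -> : u - q (x1 - x2) = (w2 - z) - (w1 - (z + u)).
    rewrite linearB q1 q2 !opprB [RHS]addrA (addrA (w2 - z)) subrK.
    by rewrite [RHS]addrAC addrC.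
  apply: le_trans (ler_normB _ _) _; apply: le_trans (lerD h2 h1) _.
  by rewrite le_eqVlt; apply/orP; left; apply/eqP; field.
exists (N * (2 / r)); first by rewrite mulr_ge0// divr_ge0// ltW.
move=> w; have [->|w0] := eqVneq w 0.
  by exists 0; rewrite linear0 subrr !normr0 !mulr0.
have nw : 0 < `|w| by rewrite normr_gt0.
(* Scales [w] to norm [r / 2]; the error [r / 4] then becomes half the norm of [w]. *)
pose c := `|w| * (2 / r).
have c0 : 0 < c by rewrite mulr_gt0// divr_gt0.
have cn : `|c| = c by rewrite gtr0_norm.
have [|x [xN ux]] := step (c^-1 *: w).
  rewrite normrZ normfV cn /c invfM mulrAC mulVf ?gt_eqF// mul1r.
  by rewrite invfM invrK mulrC.
exists (c *: x); split.
  have -> : N * (2 / r) * `|w| = c * N by rewrite /c; ring.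
  by rewrite normrZ cn ler_wpM2l// ltW.
have -> : w - q (c *: x) = c *: (c^-1 *: w - q x).
  by rewrite scalerBr scalerA divff ?gt_eqF// scale1r linearZ.
rewrite normrZ cn; apply: (@le_trans _ _ (c * (r / 4))); first by rewrite ler_wpM2l// ltW.
rewrite /c le_eqVlt; apply/orP; left; apply/eqP; field.
by rewrite gt_eqF.
Qed.

(** Successive correction: [almost_open] is applied to the remainder, which halves each time, and
    the corrections sum to at most [2 * k * |z|]. *)
Lemma open_mapping : exists2 k, 0 <= k & forall z, exists x, q x = z /\ `|x| <= k * `|z|.
Proof.
have [k k0 kP] := almost_open; exists (2 * k); first by rewrite mulr_ge0.
have [g gP] := choice kP.
have [M M0 qM] := linear_continuous_bound cq.
have p0 n : 0 <= 2^-1 ^+ n :> K by rewrite exprn_ge0// invr_ge0.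
move=> z; pose fix s n := if n is m.+1 then s m + g (z - q (s m)) else 0.
have zs n : `|z - q (s n)| <= `|z| * 2^-1 ^+ n.
  elim: n => [|n IH] /=; first by rewrite linear0 subr0 expr0 mulr1.
  rewrite linearD opprD addrA; have [_ h] := gP (z - q (s n)).
  by apply: le_trans h _; rewrite exprS mulrCA ler_wpM2l// invr_ge0.
have [|n|x xs] := @geometric_limit K hK X s (k * `|z|).
- by rewrite mulr_ge0.
- rewrite /= addrAC subrr add0r; have [h _] := gP (z - q (s n)).
  by apply: le_trans h _; rewrite -mulrA ler_wpM2l.
exists x; split; last by have := xs 0%N; rewrite /= subr0 expr0 mulr1 mulrA.
apply/eqP; rewrite -subr_eq0; apply/eqP.
apply: (@eq0_half_expn K hK Z _ (M * (2 * (k * `|z|)) + `|z|)).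
  by rewrite addr_ge0// !mulr_ge0// ltW.
move=> n; apply: le_trans (ler_distD (q (s n)) _ _) _.
rewrite [leRHS]mulrDl lerD//; last by rewrite distrC.
by rewrite -linearB (le_trans (qM _))// -mulrA ler_wpM2l// ltW.
Qed.

(** Each [z] in [C] is approximated by points [r (n, z)] of finite nets, and [s n] lifts them with
    corrections of geometric size. On [C] each [s n] takes finitely many values and converges
    uniformly to a lifting [sg], so the image of [sg] is totally bounded. *)
Lemma compact_lift (C : set Z) : compact C ->
  exists2 D, compact D & forall z, C z -> exists2 x, D x & q x = z.
Proof.
move=> /compact_totally_bounded tC.
have [k k0 kP] := open_mapping; have [g gP] := choice kP.
have qg u : q (g u) = u by have [] := gP u.
have gk u : `|g u| <= k * `|u| by have [] := gP u.
have [M M0 qM] := linear_continuous_bound cq.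
have p0 n : 0 < 2^-1 ^+ n :> K by rewrite exprn_gt0// invr_gt0.
have [t tP] := choice (fun n => tC _ (p0 n)).
have near_t (p : nat * Z) : exists y, C p.2 ->
    y \in t p.1 /\ `|p.2 - y| < 2^-1 ^+ p.1.
  case: p => n z /=; have [Cz|nC] := pselect (C z); last by exists 0.
  by have [y yt zy] := tP n z Cz; exists y.
have [r rP] := choice near_t.
pose s := fix s n (z : Z) {struct n} : X :=
  if n is m.+1 then s m z + g (r (m.+1, z) - q (s m z)) else g (r (0%N, z)).
have qs n z : q (s n z) = r (n, z).
  case: n => [|n] /=; first exact: qg.
  by rewrite linearD qg addrC subrK.
have sfin n : exists l : seq X, forall z, C z -> s n z \in l.
  elim: n => [|n [l lP]].
    by exists (map g (t 0%N)) => z Cz; apply: map_f; have [] := rP (0%N, z) Cz.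
  exists [seq x + g (y - q x) | x <- l, y <- t n.+1] => z Cz.
  apply/allpairsP; exists (s n z, r (n.+1, z)); split=> //=; first exact: lP.
  by have [] := rP (n.+1, z) Cz.
have rd n z : C z -> `|r (n, z) - z| <= 2^-1 ^+ n.
  by move=> Cz; have [_ /ltW] := rP (n, z) Cz; rewrite distrC.
have lim_s z : exists x, C z -> forall n, `|x - s n z| <= 2 * (2 * k) * 2^-1 ^+ n.
  have [Cz|nC] := pselect (C z); last by exists 0.
  have [|n|x xP] := @geometric_limit K hK X (s ^~ z) (2 * k); last by exists x.
    by rewrite mulr_ge0.
  rewrite /= addrAC subrr add0r qs (le_trans (gk _))// [2 * k]mulrC -mulrA.
  rewrite ler_wpM2l// (le_trans (ler_distD z _ _))// mulrDl mul1r lerD//; last first.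
    by rewrite distrC rd.
  apply: le_trans (rd _ _ Cz) _.
  by rewrite exprS ler_piMl ?(ltW (p0 n))// invf_le1// ler1n.
have [sg sgP] := choice lim_s.
exists (closure (sg @` C)).
  apply: totally_bounded_closure => e e0.
  have k1 : 0 < 2 * (2 * k) + 1 by rewrite ltr_wpDl// !mulr_ge0.
  have [n] := half_expn_lt hK (divr_gt0 e0 k1); rewrite ltr_pdivlMr// => hn.
  have [l lP] := sfin n; exists l => _ [z Cz <-].
  exists (s n z); first exact: lP.
  apply: le_lt_trans (sgP z Cz n) _; apply: le_lt_trans hn.
  by rewrite mulrC ler_wpM2l ?lerDl// ltW.
move=> z Cz; exists (sg z); first by apply: subset_closure; exists z.
apply/eqP; rewrite -subr_eq0; apply/eqP.
apply: (@eq0_half_expn K hK Z _ (M * (2 * (2 * k)) + 1)).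
  by rewrite addr_ge0// !mulr_ge0// ltW.
move=> n; apply: le_trans (ler_distD (q (s n z)) _ _) _.
rewrite mulrDl mul1r lerD//; last by rewrite qs rd.
by rewrite -linearB (le_trans (qM _))// -mulrA ler_wpM2l ?sgP// ltW.
Qed.

Lemma quotient_ap : pair_approximation_property [set x | q x = 0] ->
  approximation_property Z.
Proof.
move=> /id_net_limitP pX; apply/id_net_limitP => C e cC e0.
have [D cD DC] := compact_lift cC.
have [k k0 kP] := open_mapping; have [g gP] := choice kP.
have [M M0 qM] := linear_continuous_bound cq.
have [T [cT [[n [v Tv]] Tker] TD]] := pX D (e / M) cD (divr_gt0 e0 M0).
have TE x y : q x = q y -> q (T x) = q (T y).
  move=> xy; apply/eqP; rewrite -subr_eq0 -!linearB; apply/eqP/Tker.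
  by rewrite /= linearB xy subrr.
(* [g] is a bounded selection that may fail to be linear; linearity of [U] comes from [TE], by which
   [q (T x)] depends on [q x] alone. *)
have [U UE] : exists U : {linear Z -> Z}, forall z, U z = q (T (g z)).
  apply: linear_pack => a x y; rewrite -!linearP; apply: TE.
  by rewrite linearP !(gP _).1.
have Uq x : U (q x) = q (T x) by rewrite UE; apply: TE; rewrite (gP _).1.
have [N N0 TN] := linear_continuous_bound cT.
exists U; split.
- apply: (@linear_bound_continuous _ _ _ _ (M * (N * k))).
    by rewrite !mulr_ge0// ltW.
  move=> z; rewrite UE (le_trans (qM _))// -!mulrA ler_wpM2l ?(ltW M0)//.
  by rewrite (le_trans (TN _))// ler_wpM2l ?(ltW N0)// (gP _).2.
- apply: (@range_sub_finite_rank _ _ n (q \o v)) => _ [z _ <-].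
  have [c Tc] : lspan v (T (g z)) by rewrite -Tv; exists (g z).
  exists c; rewrite UE Tc linear_sum; apply: eq_bigr => j _.
  by rewrite linearZ.
- move=> z Cz; have [x Dx <-] := DC z Cz.
  rewrite Uq -linearB; apply: le_lt_trans (qM _) _.
  by rewrite mulrC -ltr_pdivlMr// TD.
Qed.

End OpenMapping.

Theorem corollary2 (K : numFieldType) (K_scalars : real_or_complex K)
    (Y X Z : completeNormedModType K)
    (i : {linear Y -> X}) (q : {linear X -> Z}) :
  short_exact i q ->
  Linfty_space X ->
  approximation_property Y ->
  pair_approximation_property (range i) /\ approximation_property Z.
Proof.
move=> [ci [c c0 ic] cq sq kerE] LX apY.
have clY : closed (range i).
  rewrite -kerE -[X in closed X]/(q @^-1` [set 0]).
  apply: closed_comp; first by move=> x _; exact: cq.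
  exact: (accessible_closed_set1 (hausdorff_accessible (@norm_hausdorff _ _))).
have pX : pair_approximation_property (range i).
  exact: (pair_ap_of_ap K_scalars ci c0 ic clY LX apY).
split=> //; apply: (quotient_ap K_scalars cq sq).
by rewrite kerE.
Qed.
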